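(* Let $\beta,\epsilon>0$. Suppose that, for any constant input $\upsilon(t)=u$, the system $\dot\xi=f(\xi,\upsilon)$ has a unique equilibrium $w(u)$, which is globally exponentially stable; that $r\ge1$ is an integer such that $f$ is $(r+1)$-times and $h$ is $(r+2)$-times continuously differentiable, $\mathcal{X}_r\ne\emptyset$, $\frac{\partial \mathcal{L}_f^r h}{\partial u}(x,u)\ne0$ for all $(x,u)\in\mathcal{X}_r$ with $h_r(x,u)=0$, and $\frac{\partial\mathcal{L}_f^i h}{\partial u}(x,u)=0$ for all $(x,u)\in\mathcal{X}_r$ and all $i<r$; that $b$ is twice continuously differentiable, and $b(u)=0\implies\nabla b(u)\ne0$ for all $(x,u)$ with $h(x)\ge0$ and $b(u)\ge0$; and that $\Phi$ and $w$ are twice continuously differentiable. Assume that $\mathcal{X}_r$ is compact and that, for any $(x,u)\in\mathcal{X}_r$, there exists $q_{(x,u)}\in\mathbb{R}^m$ such that: - if $b(u)=0$, then $\nabla^\top b(u)\,q_{(x,u)}>0$; - if $h_r(x,u)=0$, then $\frac{\partial h_r}{\partial u}(x,u)\,q_{(x,u)}+\frac{\partial h_r}{\partial x}(x,u)f(x,u)>0$. Then there exist $\alpha_f,\gamma_f>0$ such that, for all $\alpha>\alpha_f$ and $\gamma>\gamma_f$, the quadratic program $$\min_{q\in\mathbb{R}^m}\ \tfrac12\Big\|q+\epsilon\tfrac{\partial w}{\partial u}(u)^\top\nabla\Phi(x)\Big\|^2\ \text{ s.t. }\ \nabla^\top b(u)q+\alpha b(u)\ge0,\quad \tfrac{\partial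 h_r}{\partial x}(x,u)f(x,u)+\tfrac{\partial h_r}{\partial u}(x,u)q+\gamma h_r(x,u)\ge0$$ is feasible for any $(x,u)\in\mathcal{X}_r$.
   Context: Conventions: for $g:\mathbb{R}^n\times\mathbb{R}^m\to\mathbb{R}^k$, $\frac{\partial g}{\partial x}(x,u)\in\mathbb{R}^{k\times n}$; for scalar $g$, $\nabla g=(\frac{\partial g}{\partial x})^\top$ is a column vector, and $\nabla^\top g=(\nabla g)^\top$. Data: a control system $\dot\xi=f(\xi,\upsilon)$ with $f:\mathbb{R}^n\times\mathbb{R}^m\to\mathbb{R}^n$; functions $\Phi:\mathbb{R}^n\to\mathbb{R}$, $h:\mathbb{R}^n\to\mathbb{R}$, $b:\mathbb{R}^m\to\mathbb{R}$, sufficiently smooth. (A1) For any constant input $\upsilon(t)=u$, the system has a unique equilibrium, which is globally exponentially stable. $w:\mathbb{R}^m\to\mathbb{R}^n$ maps $u$ to this equilibrium, so $f(w(u),u)=0$. Notation: $\mathcal{L}_f h(x,u)=\frac{\partial h}{\partial x}(x)f(x,u)$ and $\mathcal{L}_f^i h(x,u)=\frac{\partial \mathcal{L}_f^{i-1}h}{\partial x}(x,u)f(x,u)$ for $i\ge2$. For a fixed $\beta>0$: $h_0(x,u):=h(x)$ and $h_i(x,u):=\frac{\partial h_{i-1}}{\partial x}(x,u)f(x,u)+\beta h_{i-1}(x,u)$ for $i\ge1$. Also $\mathcal{X}_i:=\{(x,u)\in\mathbb{R}^n\times\mathbb{R}^m: h(x)\ge0,\ b(u)\ge0,\ h_i(x,u)\ge0\}$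 for $i\ge 0$. (A2) (1) There exists an integer $r\ge1$ such that: $f$ is $(r+1)$-times and $h$ is $(r+2)$-times continuously differentiable; $\mathcal{X}_r\ne\emptyset$; $\frac{\partial \mathcal{L}_f^r h}{\partial u}(x,u)\ne0$ for all $(x,u)\in\mathcal{X}_r$ with $h_r(x,u)=0$; and $\frac{\partial\mathcal{L}_f^i h}{\partial u}(x,u)=0$ for all $(x,u)\in\mathcal{X}_r$ and all $i<r$. (2) $b$ is twice continuously differentiable, and $b(u)=0\implies\nabla b(u)\ne0$ for all $(x,u)\in\mathcal{X}:=\{(x,u): h(x)\ge0,\ b(u)\ge0\}$. (3) $\Phi$ and $w$ are twice continuously differentiable. Throughout, $r$ is the integer in (A2). *)

(* Defs.v *)
From mathcomp Require Import all_boot all_order all_algebra.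
From mathcomp Require Import all_classical all_reals all_analysis.

Set Implicit Arguments.
Unset Strict Implicit.
Unset Printing Implicit Defensive.

Import Order.TTheory GRing.Theory Num.Theory.
Import numFieldNormedType.Exports.

Local Open Scope classical_set_scope.
Local Open Scope ring_scope.

(* [Ck k f]: f is k times continuously differentiable on the whole space.  The
   successor case asks for Frechet differentiability everywhere and for every
   directional derivative to be C^(k-1); on a finite-dimensional V this is the
   usual notion, since x |-> 'd f x is then determined by finitely many of the
   maps x |-> 'D_v f x. *)
Fixpoint Ck (R : realType) (V W : normedModType R) (k : nat) (f : V -> W) :
    Prop :=
  if k is k'.+1 then
    (forall x : V, differentiable f x) /\
    (forall v : V, Ck k' (fun x : V => 'D_v f x))
  else continuous f.

(* R^n is 'cV[R]_n, so that Jacobians have the layout d g / d x : k x n acting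
   on columns from the left; [jacobian] of the library is the transposed
   version, for row vectors. *)
Definition Jac (R : realType) (n k : nat) (g : 'cV[R]_n -> 'cV[R]_k)
    (x : 'cV[R]_n) : 'M[R]_(k, n) :=
  \matrix_(i < k, j < n) ('D_(delta_mx j 0) g x) i 0.

Definition drow (R : realType) (n : nat) (g : 'cV[R]_n -> R) (x : 'cV[R]_n) :
    'rV[R]_n :=
  \row_(j < n) 'D_(delta_mx j 0) g x.

Definition grad (R : realType) (n : nat) (g : 'cV[R]_n -> R) (x : 'cV[R]_n) :
    'cV[R]_n :=
  (drow g x)^T.

(* The partial derivatives d g / d x (x, u) and d g / d u (x, u). *)
Definition pdx (R : realType) (n m : nat) (g : 'cV[R]_n * 'cV[R]_m -> R)
    (z : 'cV[R]_n * 'cV[R]_m) : 'rV[R]_n :=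
  drow (fun x : 'cV[R]_n => g (x, z.2)) z.1.

Definition pdu (R : realType) (n m : nat) (g : 'cV[R]_n * 'cV[R]_m -> R)
    (z : 'cV[R]_n * 'cV[R]_m) : 'rV[R]_m :=
  drow (fun u : 'cV[R]_m => g (z.1, u)) z.2.

Definition mxscal (R : realType) (A : 'M[R]_1) : R := A 0 0.

(* The norm carried by 'cV[R]_n in the library is the max norm. *)
Definition enorm (R : realType) (n : nat) (x : 'cV[R]_n) : R :=
  Num.sqrt (\sum_(i < n) x i 0 ^+ 2).

Definition is_solution (R : realType) (n m : nat)
    (f : 'cV[R]_n * 'cV[R]_m -> 'cV[R]_n) (upsilon : R -> 'cV[R]_m)
    (xi : R -> 'cV[R]_n) : Prop :=
  {within [set t : R | 0 <= t], continuous xi} /\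
  (forall t : R, 0 < t -> is_derive t (1 : R) xi (f (xi t, upsilon t))).

Definition is_equilibrium (R : realType) (n m : nat)
    (f : 'cV[R]_n * 'cV[R]_m -> 'cV[R]_n) (u : 'cV[R]_m) (x : 'cV[R]_n) :
    Prop :=
  f (x, u) = 0.

(* Global exponential stability of xs under the constant input u, including
   the existence of a solution on [0, +oo[ from every initial state. *)
Definition glob_exp_stable (R : realType) (n m : nat)
    (f : 'cV[R]_n * 'cV[R]_m -> 'cV[R]_n) (u : 'cV[R]_m) (xs : 'cV[R]_n) :
    Prop :=
  (forall x0 : 'cV[R]_n,
     exists xi : R -> 'cV[R]_n, is_solution f (fun=> u) xi /\ xi 0 = x0) /\
  (exists c lambda : R, [/\ 0 < c, 0 < lambda &
     forall xi : R -> 'cV[R]_n, is_solution f (fun=> u) xi ->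
     forall t : R, 0 <= t ->
       enorm (xi t - xs) <= c * expR (- lambda * t) * enorm (xi 0 - xs)]).

(* Iterated Lie derivatives, as functions of (x, u); index 0 is h itself. *)
Fixpoint lie (R : realType) (n m : nat) (f : 'cV[R]_n * 'cV[R]_m -> 'cV[R]_n)
    (h : 'cV[R]_n -> R) (i : nat) (z : 'cV[R]_n * 'cV[R]_m) : R :=
  if i is i'.+1 then mxscal (pdx (lie f h i') z *m f z) else h z.1.

Fixpoint hseq (R : realType) (n m : nat) (f : 'cV[R]_n * 'cV[R]_m -> 'cV[R]_n)
    (h : 'cV[R]_n -> R) (beta : R) (i : nat) (z : 'cV[R]_n * 'cV[R]_m) : R :=
  if i is i'.+1 then
    mxscal (pdx (hseq f h beta i') z *m f z) + beta * hseq f h beta i' z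
  else h z.1.

Definition Xset (R : realType) (n m : nat)
    (f : 'cV[R]_n * 'cV[R]_m -> 'cV[R]_n) (h : 'cV[R]_n -> R)
    (b : 'cV[R]_m -> R) (beta : R) (i : nat) : set ('cV[R]_n * 'cV[R]_m) :=
  [set z | [/\ 0 <= h z.1, 0 <= b z.2 & 0 <= hseq f h beta i z]].

(* The problem of minimizing [objective] over [constraints]. *)
Record minProblem (R : realType) (T : Type) := MinProblem {
  objective : T -> R;
  constraints : set T
}.

Definition feasible (R : realType) (T : Type) (P : minProblem R T) : Prop :=
  constraints P !=set0.

Definition QP (R : realType) (n m : nat)
    (f : 'cV[R]_n * 'cV[R]_m -> 'cV[R]_n) (Phi h : 'cV[R]_n -> R)
    (b : 'cV[R]_m -> R) (w : 'cV[R]_m -> 'cV[R]_n)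
    (beta epsilon : R) (r : nat) (alpha gamma : R)
    (x : 'cV[R]_n) (u : 'cV[R]_m) : minProblem R 'cV[R]_m :=
  {| objective := fun q : 'cV[R]_m =>
       2^-1 * enorm (q + epsilon *: ((Jac w u)^T *m grad Phi x)) ^+ 2;
     constraints := [set q : 'cV[R]_m |
       0 <= mxscal ((grad b u)^T *m q) + alpha * b u /\
       0 <= mxscal (pdx (hseq f h beta r) (x, u) *m f (x, u))
            + mxscal (pdu (hseq f h beta r) (x, u) *m q)
            + gamma * hseq f h beta r (x, u)] |}.

(* Main.v *)
Require Import Defs.
From HB Require Import structures.
From mathcomp Require Import all_boot all_order all_algebra.
From mathcomp Require Import all_classical all_reals all_analysis.
Import Order.TTheory GRing.Theory Num.Theory.
Import numFieldNormedType.Exports.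
Local Open Scope classical_set_scope.
Local Open Scope ring_scope.

(** Feasibility is a local matter: around each point, a single q and large
    multipliers work on a whole neighbourhood, and compactness of X_r makes the
    multipliers uniform.

    Fix z in X_r and take the q granted at z.  Each constraint, restricted to
    this fixed q, has the form 0 <= G + a * g, where g is b or h_r, hence
    nonnegative on X_r, and G is a function that is positive at z whenever
    g z = 0.  If g z = 0, then G stays positive near z and every a >= 0 will do.
    If g z > 0, then g is bounded away from 0 and G is bounded below near z, so
    every large a will do.  This dichotomy is [near_large_multiplier].  Both
    constraints therefore hold for all points of X_r near z and all (alpha,
    gamma) near (+oo, +oo), and compactness, in its near-covering form, exchanges
    the two quantifiers.

    The argument needs the functions G and g to be continuous in (x, u).  As h_r
    involves r nested derivatives along f, this rests on a small calculus of
    C^k functions: each step of the recursion that defines h_i loses one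
    derivative, so h_r is C^1 when f and h are C^(r+1) ([Ck_hseq]), and its
    partial derivatives are continuous. *)

(** * Calculus of C^k functions *)

Lemma Ck_continuous (R : realType) (V W : normedModType R) (k : nat)
    (f : V -> W) : Ck k f -> continuous f.
Proof.
by case: k => [//|k] [df _] x; exact: differentiable_continuous.
Qed.
Arguments Ck_continuous {R V W k f}.

Lemma Ck_succ (R : realType) (V W : normedModType R) (k : nat) (f : V -> W) :
  Ck k.+1 f -> Ck k f.
Proof.
elim: k f => [|k IHk] f; first exact: Ck_continuous.
by move=> [df Cf]; split=> // v; apply: IHk; exact: Cf.
Qed.
Arguments Ck_succ {R V W k f}.

Lemma Ck_le (R : realType) (V W : normedModType R) (k l : nat) (f : V -> W) :
  (k <= l)%N -> Ck l f -> Ck k f.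
Proof.
move=> /subnK <-; elim: (l - k)%N => [//|d IHd] /Ck_succ; exact: IHd.
Qed.

Lemma Ck_cst (R : realType) (V W : normedModType R) (k : nat) (c : W) :
  Ck k (fun _ : V => c).
Proof.
elim: k c => [|k IHk] c; first exact: cst_continuous.
split=> [x|v]; first exact: differentiable_cst.
have -> : (fun x => 'D_v (fun _ : V => c) x) = (fun=> 0).
  by apply/funext => x; exact: derive_cst.
exact: IHk.
Qed.

Lemma Ck_add (R : realType) (V W : normedModType R) (k : nat) (f g : V -> W) :
  Ck k f -> Ck k g -> Ck k (fun x => f x + g x).
Proof.
elim: k f g => [|k IHk] f g.
  by move=> cf cg x; apply: cvgD; [exact: cf | exact: cg].
move=> [df Cf] [dg Cg]; split=> [x|v]; first exact: differentiableD.
have -> : (fun x => 'D_v (fun x0 => f x0 + g x0) x)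
    = (fun x => 'D_v f x + 'D_v g x).
  by apply/funext => x; apply: deriveD; exact: diff_derivable.
by apply: IHk; [exact: Cf | exact: Cg].
Qed.

Lemma Ck_sum (R : realType) (V W : normedModType R) (k : nat) (I : Type)
    (s : seq I) (F : I -> V -> W) :
  (forall i, Ck k (F i)) -> Ck k (fun x => \sum_(i <- s) F i x).
Proof.
move=> CF; elim: s => [|i s IHs].
  have -> : (fun x => \sum_(i <- [::]) F i x) = (fun=> 0).
    by apply/funext => x; rewrite big_nil.
  exact: Ck_cst.
have -> : (fun x => \sum_(j <- i :: s) F j x)
    = (fun x => F i x + \sum_(j <- s) F j x).
  by apply/funext => x; rewrite big_cons.
exact: Ck_add.
Qed.

(** In the Leibniz rule f and g occur undifferentiated next to derivatives that
    are only C^k; lowering their own order by [Ck_succ] closes the induction. *)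
Lemma Ck_mul (R : realType) (V : normedModType R) (k : nat) (f g : V -> R) :
  Ck k f -> Ck k g -> Ck k (fun x => f x * g x).
Proof.
elim: k f g => [|k IHk] f g.
  by move=> cf cg x; apply: cvgM; [exact: cf | exact: cg].
move=> Cf Cg; have [[df Df] [dg Dg]] := (Cf, Cg).
split=> [x|v]; first exact: differentiableM.
have -> : (fun x => 'D_v (fun x0 => f x0 * g x0) x)
    = (fun x => f x * 'D_v g x + g x * 'D_v f x).
  by apply/funext => x; apply: deriveM; exact: diff_derivable.
by apply: Ck_add; apply: IHk; [exact: Ck_succ | exact: Dg
  | exact: Ck_succ | exact: Df].
Qed.

Lemma derive_postcomp (R : realType) (V W W' : normedModType R)
    (L : {linear W -> W'}) (f : V -> W) (x v : V) :
  continuous L -> differentiable f x ->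
  'D_v (fun y => L (f y)) x = L ('D_v f x).
Proof.
move=> cL df.
have dL := linear_differentiable (f x) cL.
by rewrite deriveE ?deriveE//; [rewrite (diff_comp df dL) /= (diff_lin _ cL)
  | exact: (differentiable_comp df dL)].
Qed.

Lemma Ck_postcomp (R : realType) (V W W' : normedModType R)
    (L : {linear W -> W'}) (k : nat) (f : V -> W) :
  continuous L -> Ck k f -> Ck k (fun x => L (f x)).
Proof.
move=> cL; elim: k f => [|k IHk] f.
  by move=> cf x; apply: continuous_comp; [exact: cf | exact: cL].
move=> [df Cf]; split=> [x|v].
  exact: (differentiable_comp (df x) (linear_differentiable (f x) cL)).
have -> : (fun x => 'D_v (fun y => L (f y)) x) = (fun x => L ('D_v f x)).
  by apply/funext => x; exact: derive_postcomp.
by apply: IHk; exact: Cf.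
Qed.

Lemma Ck_precomp (R : realType) (U V W : normedModType R)
    (L : {linear U -> V}) (k : nat) (f : V -> W) :
  continuous L -> Ck k f -> Ck k (fun x => f (L x)).
Proof.
move=> cL; elim: k f => [|k IHk] f.
  by move=> cf x; apply: continuous_comp; [exact: cL | exact: cf].
move=> [df Cf].
have dL x := linear_differentiable x cL.
split=> [x|v]; first exact: (differentiable_comp (dL x) (df (L x))).
have -> : (fun x => 'D_v (fun y => f (L y)) x) = (fun x => 'D_(L v) f (L x)).
  apply/funext => x; rewrite !deriveE//.
    by rewrite (diff_comp (dL x) (df (L x))) /= (diff_lin _ cL).
  exact: (differentiable_comp (dL x) (df (L x))).
exact: (IHk ('D_(L v) f) (Cf (L v))).
Qed.

Lemma Ck_coord (R : realType) (V : normedModType R) (p q k : nat)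
    (f : V -> 'M[R]_(p, q)) (i : 'I_p) (j : 'I_q) :
  Ck k f -> Ck k (fun x => f x i j).
Proof.
have lin : linear (fun M : 'M[R]_(p, q) => M i j : R).
  by move=> a M N; rewrite !mxE.
pose L := GRing.isLinear.Build _ _ _ _ _ lin.
pose f0 : {linear 'M[R]_(p, q) -> R} := HB.pack (fun M : 'M[R]_(p, q) => M i j : R) L.
by move=> Cf; apply: (@Ck_postcomp _ _ _ _ f0) => //; exact: coord_continuous.
Qed.

Lemma Ck_comp_fst (R : realType) (V V' W : normedModType R) (k : nat)
    (f : V -> W) : Ck k f -> Ck k (fun z : V * V' => f z.1).
Proof.
by apply: (@Ck_precomp _ (V * V')%type V W (fst : {linear (V * V')%type -> V}));
  move=> z; exact: cvg_fst.
Qed.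

Lemma Ck_comp_snd (R : realType) (V V' W : normedModType R) (k : nat)
    (f : V' -> W) : Ck k f -> Ck k (fun z : V * V' => f z.2).
Proof.
by apply: (@Ck_precomp _ (V * V')%type V' W (snd : {linear (V * V')%type -> V'}));
  move=> z; exact: cvg_snd.
Qed.

(** * Regularity of the functions h_i *)

(** A partial derivative along v is the full directional derivative along
    (v, 0): both are limits of the same difference quotient.  This lets
    statements about [Ck] on the product space control [pdx] and [pdu]. *)
Lemma derive_slice_fst (R : realType) (V V' W : normedModType R)
    (g : V * V' -> W) (z : V * V') (v : V) :
  'D_v (fun x => g (x, z.2)) z.1 = 'D_(v, 0) g z.
Proof.
have E (t : R) : g (t *: v + z.1, z.2) = g (t *: (v, 0) + z).
  by case: z => x y; congr (g (_, _)); rewrite /= scaler0 add0r.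
rewrite /derive -surjective_pairing /=.
under eq_fun do rewrite /= E.
by [].
Qed.

Lemma derive_slice_snd (R : realType) (V V' W : normedModType R)
    (g : V * V' -> W) (z : V * V') (v : V') :
  'D_v (fun y => g (z.1, y)) z.2 = 'D_(0, v) g z.
Proof.
have E (t : R) : g (z.1, t *: v + z.2) = g (t *: (0, v) + z).
  by case: z => x y; congr (g (_, _)); rewrite /= scaler0 add0r.
rewrite /derive -surjective_pairing /=.
under eq_fun do rewrite /= E.
by [].
Qed.

Lemma Ck_mxscal_pdx (R : realType) (n m k : nat)
    (g : 'cV[R]_n * 'cV[R]_m -> R) (F : 'cV[R]_n * 'cV[R]_m -> 'cV[R]_n) :
  Ck k.+1 g -> Ck k F -> Ck k (fun z => mxscal (pdx g z *m F z)).
Proof.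
move=> [_ Cg] CF.
have -> : (fun z => mxscal (pdx g z *m F z))
    = (fun z => \sum_(j < n) 'D_(delta_mx j 0, 0) g z * F z j 0).
  by apply/funext => z; rewrite /mxscal mxE; apply: eq_bigr => j _;
    rewrite mxE derive_slice_fst.
by apply: Ck_sum => j; apply: Ck_mul; [exact: Cg | exact: Ck_coord].
Qed.

Lemma Ck_mxscal_pdu (R : realType) (n m k : nat)
    (g : 'cV[R]_n * 'cV[R]_m -> R) (F : 'cV[R]_n * 'cV[R]_m -> 'cV[R]_m) :
  Ck k.+1 g -> Ck k F -> Ck k (fun z => mxscal (pdu g z *m F z)).
Proof.
move=> [_ Cg] CF.
have -> : (fun z => mxscal (pdu g z *m F z))
    = (fun z => \sum_(j < m) 'D_(0, delta_mx j 0) g z * F z j 0).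
  by apply/funext => z; rewrite /mxscal mxE; apply: eq_bigr => j _;
    rewrite mxE derive_slice_snd.
by apply: Ck_sum => j; apply: Ck_mul; [exact: Cg | exact: Ck_coord].
Qed.

Lemma Ck_mxscal_grad (R : realType) (m k : nat) (b : 'cV[R]_m -> R)
    (q : 'cV[R]_m) :
  Ck k.+1 b -> Ck k (fun u => mxscal ((grad b u)^T *m q)).
Proof.
move=> [_ Cb].
have -> : (fun u => mxscal ((grad b u)^T *m q))
    = (fun u => \sum_(j < m) 'D_(delta_mx j 0) b u * q j 0).
  by apply/funext => u; rewrite /mxscal trmxK mxE; apply: eq_bigr => j _;
    rewrite mxE.
by apply: Ck_sum => j; apply: Ck_mul; [exact: Cb | exact: Ck_cst].
Qed.

(** The induction on i runs with k free, since passing from h_i to h_(i+1)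
    differentiates h_i once and so consumes one order of smoothness. *)
Lemma Ck_hseq (R : realType) (n m : nat)
    (f : 'cV[R]_n * 'cV[R]_m -> 'cV[R]_n) (h : 'cV[R]_n -> R) (beta : R)
    (k i : nat) :
  Ck (i + k) f -> Ck (i + k) h -> Ck k (hseq f h beta i).
Proof.
elim: i k => [|i IHi] k Cf Ch; first exact: Ck_comp_fst.
have Chi : Ck k.+1 (hseq f h beta i) by apply: IHi; rewrite addnS.
apply: Ck_add.
  by apply: Ck_mxscal_pdx => //; apply: Ck_le Cf; exact: leq_addl.
by apply: Ck_mul; [exact: Ck_cst | exact: Ck_succ].
Qed.

(** * Uniform multipliers *)

(** This is the local form of the feasibility argument for one constraint.  The
    case distinction is on g z: if it vanishes, the sign of G z settles the
    inequality; otherwise a * g y eventually dominates G y. *)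
Lemma near_large_multiplier (R : realType) (X : topologicalType) (S : set X)
    (G g : X -> R) (z : X) :
  continuous G -> continuous g -> S z -> (forall y, S y -> 0 <= g y) ->
  (g z = 0 -> 0 < G z) ->
  \forall y \near z & a \near +oo, S y -> 0 <= G y + a * g y.
Proof.
move=> cG cg Sz g_ge0 Gz_gt0.
have [gz0|gz_neq0] := eqVneq (g z) 0.
  have {}Gz_gt0 := Gz_gt0 gz0.
  near=> y a => Sy.
  have Gy : 0 < G y by near: y; exact: (cvgr_gt _ (cG z)).
  have a_ge0 : 0 <= a by near: a; exact: nbhs_pinfty_ge.
  by rewrite addr_ge0 ?mulr_ge0 ?g_ge0// ltW.
have gz_gt0 : 0 < g z by rewrite lt_neqAle eq_sym gz_neq0 g_ge0.
pose c := g z / 2.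
have c_gt0 : 0 < c by rewrite divr_gt0.
near=> y a => Sy.
have gy : c <= g y.
  apply: ltW; near: y; apply: (cvgr_gt _ (cg z)).
  by rewrite /c ltr_pdivrMr// ltr_pMr// ltr1n.
have Gy : G z - 1 <= G y.
  by apply: ltW; near: y; apply: (cvgr_gt _ (cG z)); rewrite ltrBlDr ltrDl.
(* With g >= c and G >= G z - 1 near z, this bound on a gives a * g >= - G. *)
have a_ge : `|G z - 1| / c <= a by near: a; exact: nbhs_pinfty_ge (num_real _).
rewrite -lerBlDl sub0r.
apply: (@le_trans _ _ (`|G z - 1| / c * g y)); last first.
  by apply: ler_wpM2r => //; exact: g_ge0.
apply: (@le_trans _ _ `|G z - 1|).
  apply: (@le_trans _ _ (- (G z - 1))); first by rewrite lerN2.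
  by rewrite -normrN; exact: ler_norm.
by rewrite mulrAC ler_pdivlMr// ler_wpM2l.
Unshelve. all: by end_near. Qed.
Arguments near_large_multiplier {R X S G g z}.

Theorem mainTheorem3 (R : realType) (n m : nat)
    (f : 'cV[R]_n * 'cV[R]_m -> 'cV[R]_n)
    (Phi h : 'cV[R]_n -> R) (b : 'cV[R]_m -> R) (w : 'cV[R]_m -> 'cV[R]_n)
    (beta epsilon : R) (r : nat)
    (beta_gt0 : 0 < beta) (epsilon_gt0 : 0 < epsilon)
    (w_equilibrium : forall u : 'cV[R]_m,
       [/\ is_equilibrium f u (w u),
           forall x : 'cV[R]_n, is_equilibrium f u x -> x = w u &
           glob_exp_stable f u (w u)])
    (r_ge1 : (1 <= r)%N)
    (f_smooth : Ck r.+1 f) (h_smooth : Ck r.+2 h)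
    (Xr_nonempty : Xset f h b beta r !=set0)
    (pdu_lie_r : forall (x : 'cV[R]_n) (u : 'cV[R]_m),
       Xset f h b beta r (x, u) -> hseq f h beta r (x, u) = 0 ->
       pdu (lie f h r) (x, u) <> 0)
    (pdu_lie_lt : forall (x : 'cV[R]_n) (u : 'cV[R]_m) (i : nat),
       Xset f h b beta r (x, u) -> (i < r)%N ->
       pdu (lie f h i) (x, u) = 0)
    (b_smooth : Ck 2 b)
    (b_regular : forall (x : 'cV[R]_n) (u : 'cV[R]_m),
       0 <= h x -> 0 <= b u -> b u = 0 -> grad b u <> 0)
    (Phi_smooth : Ck 2 Phi) (w_smooth : Ck 2 w)
    (Xr_compact : compact (Xset f h b beta r))
    (q_exists : forall (x : 'cV[R]_n) (u : 'cV[R]_m),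
       Xset f h b beta r (x, u) ->
       exists q : 'cV[R]_m,
         (b u = 0 -> 0 < mxscal ((grad b u)^T *m q)) /\
         (hseq f h beta r (x, u) = 0 ->
            0 < mxscal (pdu (hseq f h beta r) (x, u) *m q)
                + mxscal (pdx (hseq f h beta r) (x, u) *m f (x, u)))) :
  exists alpha_f gamma_f : R,
    [/\ 0 < alpha_f, 0 < gamma_f &
        forall alpha gamma : R, alpha_f < alpha -> gamma_f < gamma ->
        forall (x : 'cV[R]_n) (u : 'cV[R]_m), Xset f h b beta r (x, u) ->
        feasible (QP f Phi h b w beta epsilon r alpha gamma x u)].
Proof.
have hr_C1 : Ck 1 (hseq f h beta r).
  by apply: Ck_hseq; rewrite addn1 //; exact: Ck_succ.
have f_C0 := Ck_continuous f_smooth.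
pose Feas (p : R * R) (z : 'cV[R]_n * 'cV[R]_m) := Xset f h b beta r z ->
  feasible (QP f Phi h b w beta epsilon r p.1 p.2 z.1 z.2).
have /(_ _ (filter_prod +oo +oo) Feas) cov :=
  (iffLR (compact_near_coveringP _)) Xr_compact.
have [[A B] [/= [M1 [_ AM]] [M2 [_ BM]]] AB] :
    \forall p \near filter_prod (+oo : set_system R) (+oo : set_system R),
    Xset f h b beta r `<=` Feas p.
  apply: cov => -[x u] Xxu.
  have [q [qb qh]] := q_exists _ _ Xxu.
  have C_b : Ck 2 (fun z : 'cV[R]_n * 'cV[R]_m => b z.2) by exact: Ck_comp_snd.
  have C_gradb : Ck 0 (fun z : 'cV[R]_n * 'cV[R]_m =>
      mxscal ((grad b z.2)^T *m q)).
    exact: (Ck_comp_snd _ _ _ _ _ (fun u => mxscal ((grad b u)^T *m q))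
      (Ck_mxscal_grad _ _ _ _ _ (Ck_succ b_smooth))).
  have C_hr : Ck 0 (fun z => mxscal (pdx (hseq f h beta r) z *m f z)
      + mxscal (pdu (hseq f h beta r) z *m q)).
    apply: Ck_add; first exact: Ck_mxscal_pdx.
    by apply: Ck_mxscal_pdu => //; exact: Ck_cst.
  have [[U1 A1] [/= U1xu A1oo] near1] : \forall z \near (x, u) & a \near +oo,
      Xset f h b beta r z -> 0 <= mxscal ((grad b z.2)^T *m q) + a * b z.2.
    apply: (near_large_multiplier _ _ Xxu _ qb) => [||z []//].
    - exact: (Ck_continuous C_gradb).
    - exact: (Ck_continuous C_b).
  have [[U2 A2] [/= U2xu A2oo] near2] : \forall z \near (x, u) & c \near +oo,
      Xset f h b beta r z ->
      0 <= mxscal (pdx (hseq f h beta r) z *m f z)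
           + mxscal (pdu (hseq f h beta r) z *m q) + c * hseq f h beta r z.
    apply: (near_large_multiplier _ _ Xxu) => [||z []//|].
    - exact: (Ck_continuous C_hr).
    - exact: (Ck_continuous hr_C1).
    - by rewrite addrC.
  exists (U1 `&` U2, A1 `*` A2).
    split; first exact: filterI.
    by exists (A1, A2).
  move=> [z [a c]] /= [[U1z U2z] [A1a A2c]] Xz; exists q; split.
    exact: (near1 (z, a)).
  by case: z Xz U1z U2z => x' u' Xz U1z U2z; exact: (near2 ((x', u'), c)).
(* The thresholds M1, M2 of the neighbourhoods of +oo need not be positive. *)
exists (Num.max 1 M1), (Num.max 1 M2).
split; rewrite ?lt_max ?ltr01// => a c; rewrite !gt_max => /andP[_ a_gt].
move=> /andP[_ c_gt] x u Xxu.
exact: (AB (a, c) (conj (AM _ a_gt) (BM _ c_gt)) (x, u)).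
Qed.
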